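(* Let $\mathbb{F}$ be a field, let $\Delta$ be a finitely generated subring of $\mathbb{F}$, let $\varrho$ be an ideal of $\Delta$, and let $G$ be a finitely generated subgroup of $\mathrm{GL}(n,\Delta)$. Suppose that $\mathcal{G}(n,\Delta,\varrho)$ is torsion-free if $\mathrm{char}\,\Delta=0$, and that all torsion elements of $\mathcal{G}(n,\Delta,\varrho)$ are unipotent if $\mathrm{char}\,\Delta>0$. Suppose that $G$ is completely reducible as a subgroup of $\mathrm{GL}(n,\mathbb{F})$. Then $G$ is nilpotent if and only if $\psi_\varrho(G)$ is nilpotent and $G_\varrho\leq \mathsf{Z}(G)$.
   Context: For an ideal $\varrho$ of an integral domain $\Delta$, $\psi_\varrho:\mathrm{GL}(n,\Delta)\rightarrow\mathrm{GL}(n,\Delta/\varrho)$ denotes the group homomorphism obtained by applying the natural surjection $\Delta\to\Delta/\varrho$ entrywise; its kernel is the congruence subgroup $\mathcal{G}(n,\Delta,\varrho)$. For $G\leq\mathrm{GL}(n,\Delta)$, $G_\varrho:=G\cap\mathcal{G}(n,\Delta,\varrho)$. $\mathsf{Z}(G)$ is the center of $G$. $G\leq\mathrm{GL}(n,\mathbb{F})$ is completely reducible if $\mathbb{F}^n$ is a completely reducible (semisimple) $G$-module. A matrix is unipotent if all its eigenvalues are $1$. *)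

(* Defs.v *)
From HB Require Import structures.
From mathcomp Require Import all_boot all_order all_algebra.
From mathcomp Require Import boolp classical_sets.

Set Implicit Arguments.
Unset Strict Implicit.
Unset Printing Implicit Defensive.

Import GRing.Theory.

Local Open Scope classical_set_scope.
Local Open Scope ring_scope.

Section Subring.

Variables (F : fieldType) (D : subringClosed F).

Record subring_of := SubringOf {
  subring_val : F;
  subring_valP : subring_val \in D
}.

HB.instance Definition _ := [isSub for subring_val].
HB.instance Definition _ := [Choice of subring_of by <:].
HB.instance Definition _ := [SubChoice_isSubComNzRing of subring_of by <:].
HB.instance Definition _ :=
  GRing.RMorphism.copy subring_val (val : subring_of -> F).

Definition fg_subring : Prop :=
  exists s : seq F, {subset s <= D} /\
    forall E : subringClosed F, {subset s <= E} -> {subset D <= E}.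

End Subring.

(* The ideals of [ring_quotient] are required to be proper; those below need
   not be, so that the quotient is possibly the zero ring. *)
HB.mixin Record isIdeal (R : comPzRingType) (S : R -> bool) := {
  ideal_mulr_closed : forall a, {in S, forall u, a * u \in S}
}.

#[short(type="ideal")]
HB.structure Definition Ideal (R : comPzRingType) :=
  {S of GRing.ZmodClosed R S & isIdeal R S}.

Section IdealQuotient.

Variables (R : comPzRingType) (I : ideal R).

Local Open Scope quotient_scope.

Definition ideal_quotient := Quotient.quot I.

HB.instance Definition _ := GRing.Zmodule.on ideal_quotient.

Definition ideal_proj (x : R) : ideal_quotient := \pi_(Quotient.quot I) x.

Definition iq_one : ideal_quotient := ideal_proj 1.
Definition iq_mul (x y : ideal_quotient) : ideal_quotient :=
  ideal_proj (repr (x : Quotient.quot I) * repr (y : Quotient.quot I)).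

Lemma ideal_projP x y : reflect (ideal_proj x = ideal_proj y) (x - y \in I).
Proof. by rewrite Quotient.idealrBE; apply: eqP. Qed.

Lemma ideal_projK (x : ideal_quotient) :
  ideal_proj (repr (x : Quotient.quot I)) = x.
Proof. exact: reprK. Qed.

Lemma ideal_proj_mul x y : ideal_proj (x * y) = iq_mul (ideal_proj x) (ideal_proj y).
Proof.
rewrite /iq_mul; set x' := repr _; set y' := repr _.
have Ex : x - x' \in I by apply/ideal_projP; rewrite ideal_projK.
have Ey : y - y' \in I by apply/ideal_projP; rewrite ideal_projK.
apply/ideal_projP; rewrite -(subrK (x * y') (x * y)) -mulrBr -addrA -mulrBl.
by apply: rpredD; [|rewrite mulrC]; apply: ideal_mulr_closed.
Qed.

Lemma ideal_proj_zmod_morphism : zmod_morphism ideal_proj.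
Proof. by move=> x y; rewrite /ideal_proj raddfB. Qed.

HB.instance Definition _ :=
  GRing.isZmodMorphism.Build R ideal_quotient ideal_proj
    ideal_proj_zmod_morphism.

Lemma iq_mulA : associative iq_mul.
Proof.
move=> x y z; rewrite -[x]ideal_projK -[y]ideal_projK -[z]ideal_projK.
by rewrite -!ideal_proj_mul mulrA.
Qed.

Lemma iq_mulC : commutative iq_mul.
Proof. by move=> x y; rewrite /iq_mul mulrC. Qed.

Lemma iq_mul1 : left_id iq_one iq_mul.
Proof. by move=> x; rewrite -[x]ideal_projK -ideal_proj_mul mul1r. Qed.

Lemma iq_mulDl : left_distributive iq_mul +%R.
Proof.
move=> x y z; rewrite -[x]ideal_projK -[y]ideal_projK -[z]ideal_projK.
by rewrite -raddfD -!ideal_proj_mul mulrDl raddfD.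
Qed.

HB.instance Definition _ := GRing.Zmodule_isComPzRing.Build ideal_quotient
  iq_mulA iq_mulC iq_mul1 iq_mulDl.

Lemma ideal_proj_monoid_morphism : monoid_morphism ideal_proj.
Proof. by split=> // x y; rewrite ideal_proj_mul. Qed.

HB.instance Definition _ :=
  GRing.isMonoidMorphism.Build R ideal_quotient ideal_proj
    ideal_proj_monoid_morphism.

End IdealQuotient.

Section GeneralLinear.

Variables (n : nat) (R : pzRingType).

Definition invertible_mx (A : 'M[R]_n) : Prop :=
  exists B : 'M[R]_n, A *m B = 1%:M /\ B *m A = 1%:M.

(* [unitmx] requires a unitRingType, a structure that a quotient ring lacks in
   general (it may be the zero ring); hence the explicit two-sided inverse. *)
Record GL := MkGL {
  GL_val : 'M[R]_n;
  GL_valP : `[< invertible_mx GL_val >]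
}.

HB.instance Definition _ := [isSub for GL_val].
HB.instance Definition _ := [Choice of GL by <:].

Lemma GL_inv_ex (g : GL) :
  {B : 'M[R]_n | GL_val g *m B = 1%:M /\ B *m GL_val g = 1%:M}.
Proof. exact: cid (asboolW (GL_valP g)). Qed.

Lemma GL_one_subproof : `[< invertible_mx 1%:M >].
Proof. by apply/asboolT; exists 1%:M; rewrite mulmx1. Qed.

Lemma GL_mul_subproof (g h : GL) : `[< invertible_mx (GL_val g *m GL_val h) >].
Proof.
have [A [gA Ag]] := GL_inv_ex g; have [B [hB Bh]] := GL_inv_ex h.
apply/asboolT; exists (B *m A); split.
  by rewrite mulmxA -(mulmxA (GL_val g)) hB mulmx1.
by rewrite mulmxA -(mulmxA B) Ag mulmx1.
Qed.

Lemma GL_inv_subproof (g : GL) : `[< invertible_mx (sval (GL_inv_ex g)) >].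
Proof. by case: GL_inv_ex => B [gB Bg] /=; apply/asboolT; exists (GL_val g). Qed.

Definition GL_one : GL := @MkGL 1%:M GL_one_subproof.
Definition GL_mul (g h : GL) : GL :=
  @MkGL (GL_val g *m GL_val h) (GL_mul_subproof g h).
Definition GL_inv (g : GL) : GL :=
  @MkGL (sval (GL_inv_ex g)) (GL_inv_subproof g).

Lemma GL_mulA : associative GL_mul.
Proof. by move=> x y z; apply: val_inj; rewrite /= mulmxA. Qed.
Lemma GL_mul1 : left_id GL_one GL_mul.
Proof. by move=> x; apply: val_inj; rewrite /= mul1mx. Qed.
Lemma GL_mulr1 : right_id GL_one GL_mul.
Proof. by move=> x; apply: val_inj; rewrite /= mulmx1. Qed.
Lemma GL_mulV : left_inverse GL_one GL_inv GL_mul.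
Proof. by move=> x; apply: val_inj => /=; case: GL_inv_ex => B []. Qed.
Lemma GL_mulrV : right_inverse GL_one GL_inv GL_mul.
Proof. by move=> x; apply: val_inj => /=; case: GL_inv_ex => B []. Qed.

HB.instance Definition _ :=
  isGroup.Build GL GL_mulA GL_mul1 GL_mulr1 GL_mulV GL_mulrV.

End GeneralLinear.

Section MapGL.

Variables (n : nat) (R S : pzRingType) (f : {rmorphism R -> S}).

Lemma GLmap_subproof (g : GL n R) : `[< invertible_mx (map_mx f (GL_val g)) >].
Proof.
have [B [gB Bg]] := GL_inv_ex g.
by apply/asboolT; exists (map_mx f B); rewrite -!map_mxM gB Bg map_mx1.
Qed.

Definition GLmap (g : GL n R) : GL n S :=
  @MkGL n S (map_mx f (GL_val g)) (GLmap_subproof g).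

Lemma GLmapF : {morph GLmap : x y / (x / y)%g}.
Proof.
have M x y : GLmap (x * y)%g = (GLmap x * GLmap y)%g.
  by apply: val_inj; rewrite /= map_mxM.
by move=> x y; apply: (@mulIg _ (GLmap y)); rewrite -M !mulgVK.
Qed.

HB.instance Definition _ :=
  isGroupMorphism.Build (GL n R) (GL n S) GLmap GLmapF.

End MapGL.

Section Groups.

Variable gT : groupType.

Local Open Scope group_scope.

Definition fg_subgroup (G : groupClosed gT) : Prop :=
  exists s : seq gT, {subset s <= G} /\
    forall H : groupClosed gT, {subset s <= H} -> {subset G <= H}.

Definition gen_subgroup (A : set gT) : set gT :=
  [set x | forall H : groupClosed gT, A `<=` [set` H] -> x \in H].

Definition commg_subgroup (A B : set gT) : set gT :=
  gen_subgroup [set [~ a, b] | a in A & b in B].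

(* [lcs G i] is the (i+1)-st term of the lower central series of G. *)
Definition lcs (G : set gT) (i : nat) : set gT :=
  iter i (fun H => commg_subgroup H G) G.

Definition nilpotent_group (G : set gT) : Prop :=
  exists c : nat, lcs G c = [set 1].

Definition center_group (G : set gT) : set gT :=
  [set z | G z /\ forall g, G g -> commute z g].

Definition torsion_elt (g : gT) : Prop := exists2 m : nat, (0 < m)%N & g ^+ m = 1.

Definition torsion_free (G : set gT) : Prop :=
  forall g, G g -> torsion_elt g -> g = 1.

End Groups.

Section Congruence.

Variables (n : nat) (R : comPzRingType) (rho : ideal R).

Definition psi : GL n R -> GL n (ideal_quotient rho) :=
  GLmap (@ideal_proj R rho).
HB.instance Definition _ := UMagmaMorphism.on psi.

Definition congruence_subgroup : set (GL n R) := [set g | psi g = 1%g].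

End Congruence.

Arguments psi n {R} rho _.
Arguments congruence_subgroup n {R} rho _.

(* The eigenvalues of A are those in an algebraic closure of F, i.e. in all
   extension fields of F. *)
Definition unipotent_mx (F : fieldType) (n : nat) (A : 'M[F]_n) : Prop :=
  forall (L : fieldType) (f : {rmorphism F -> L}) (a : L),
    eigenvalue (map_mx f A) a -> a = 1.

(* As for [mx_completely_reducible] in [mxrepresentation]: every submodule of
   the module of row vectors has a complementary submodule. *)
Definition completely_reducible (F : fieldType) (n : nat)
    (G : set (GL n F)) : Prop :=
  forall U : 'M[F]_n, (forall g, G g -> stablemx U (GL_val g)) ->
  exists V : 'M[F]_n, [/\ forall g, G g -> stablemx V (GL_val g),
    (U :&: V)%MS = 0 & (U + V :=: (1%:M : 'M[F]_n))%MS].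

(* Main.v *)
(* A commutator z = [g, h] that is central acts on each of its eigenspaces
   (over any extension field) by a scalar a, and comparing the determinants of
   gh and hgz there gives a^d = 1, d being the dimension; so a^(n!) = 1 and
   z^(n!) is unipotent.  In a completely reducible group a central unipotent
   element is trivial, because a complement of its fixed space is a submodule
   on which u - 1 is both injective and nilpotent.  Hence z is torsion; if g
   lies in G_rho then so does z, which is therefore 1 in characteristic 0, and
   unipotent, hence again 1, in positive characteristic.  Descending along the
   lower central series of a nilpotent G, all such commutators are central, so
   G_rho is central. *)

From HB Require Import structures.
Require Import Defs.
From mathcomp Require Import all_boot all_order all_algebra fieldext.
From mathcomp Require Import boolp classical_sets.
Import GRing.Theory.

Local Open Scope classical_set_scope.
Local Open Scope ring_scope.

(** * Matrices whose eigenvalues are roots of unity *)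

Lemma irreducible_factor (F : fieldType) (q : {poly F}) :
  (1 < size q)%N -> exists2 p, irreducible_poly p & p %| q.
Proof.
have [m] := ubnP (size q); elim: m q => // m IHm q /ltnSE le_qm q_gt1.
have q0 : q != 0 by rewrite -size_poly_gt0 ltnW.
have [q_irr | q_red] := pselect (irreducible_poly q); first by exists q.
have [d d1 [dq qd]] : exists2 d : {poly F}, size d != 1%N & d %| q /\ ~ d %= q.
  apply: contrapT => no_d; apply: q_red; split=> // d d1 dq.
  by apply: contrapT => qd; apply: no_d; exists d.
have d0 : d != 0 by apply: contraNneq q0 => d0; rewrite -dvd0p -d0.
have lt_dq : (size d < size q)%N.
  by rewrite ltn_neqAle dvdp_size_eqp// dvdp_leq// andbT; apply/negP.
have [||p p_irr pd] := IHm d; first exact: leq_trans le_qm.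
  by rewrite ltn_neqAle eq_sym d1 size_poly_gt0.
by exists p => //; apply: dvdp_trans dq.
Qed.

(** Induction on the degree: each irreducible factor split off from [q] is paid for by one more
    factor [r]. *)
Lemma dvdp_exp_irreducible (F : fieldType) (q r : {poly F}) :
  q != 0 -> (forall p, irreducible_poly p -> p %| q -> p %| r) ->
  exists k, q %| r ^+ k.
Proof.
have [m] := ubnP (size q); elim: m q => // m IHm q /ltnSE le_qm q0 q_r.
have [q_gt1 | q_le1] := ltnP 1 (size q); last first.
  exists 0; rewrite expr0 dvdp1 eqn_leq q_le1.
  by rewrite size_poly_gt0.
have [p p_irr pq] := irreducible_factor F q q_gt1.
have Dq := divpK pq; have := q0; rewrite -{1}Dq mulf_eq0 negb_or => /andP[s0 p0].
have [||p' p'_irr p's|k s_rk] := IHm (q %/ p).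
- apply: leq_trans le_qm; rewrite size_divp// ltn_subrL.
  by rewrite (ltnW q_gt1) andbT -subn1 subn_gt0; case: p_irr.
- by [].
- by apply: q_r => //; rewrite -Dq dvdp_mulr.
- by exists k.+1; rewrite -Dq exprSr dvdp_mul// q_r.
Qed.

(** The characteristic polynomial divides a power of ['X^N - 1], so Cayley-Hamilton applies.
    Adjoining one root of one irreducible factor at a time suffices, without a splitting field. *)
Lemma eigenvalue_root1_nilp (F : fieldType) (n N : nat) (A : 'M[F]_n) :
  (forall (L : fieldType) (f : {rmorphism F -> L}) (a : L),
     eigenvalue (map_mx f A) a -> a ^+ N = 1) ->
  exists k, (A ^+ N - 1) ^+ k = 0.
Proof.
case: n A => [|n] A eigA; first by exists 0; apply/matrixP=> - [].
have [p p_irr pA|k] :=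
  dvdp_exp_irreducible F (char_poly A) ('X^N - 1) (monic_neq0 (char_poly_monic A)).
  have [L _ [z pz _]] := irredp_FAdjoin p_irr.
  have zN : z ^+ N = 1.
    apply: (eigA L (GRing.in_alg L)).
    rewrite eigenvalue_root_char -map_char_poly.
    by move: pz; rewrite -!dvdp_XsubCl => /dvdp_trans; apply; rewrite dvdp_map.
  (* An irreducible [p] not dividing ['X^N - 1] is coprime to it, also over [L], which the common
     root [z] forbids. *)
  apply: contraPT pz; rewrite -irreducible_poly_coprime//.
  rewrite -(coprimep_map (GRing.in_alg L)) => /coprimep_root/[apply].
  by rewrite rmorphB rmorphXn /= map_polyX rmorph1 !hornerE zN subrr eqxx.
rewrite dvdp_eq => /eqP Dk; exists k.
have := congr1 (horner_mx A) Dk.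
by rewrite rmorphM/= Cayley_Hamilton mulr0 rmorphXn rmorphB rmorphXn /= horner_mx_X rmorph1.
Qed.

Lemma commutator_eigenvalue_root1 (F : fieldType) (n : nat) (A B Z : 'M[F]_n)
    (a : F) :
  A \in unitmx -> B \in unitmx -> comm_mx Z A -> comm_mx Z B ->
  A *m B = B *m A *m Z -> eigenvalue Z a -> a ^+ n`! = 1.
Proof.
move=> uA uB cZA cZB AB eigZ.
(* The rows of [W] are a basis of the eigenspace, so restrictions to it become square matrices with
   determinants. *)
have [W freeW eqW] : exists2 W : 'M_(\rank (eigenspace Z a), n),
    row_free W & (W :=: eigenspace Z a)%MS.
  by exists (row_base (eigenspace Z a)); [apply: row_base_free | apply: eq_row_base].
have WZ : W *m Z = a *: W by apply/eigenspaceP; rewrite eqW.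
have restrW C : C \in unitmx -> comm_mx Z C ->
    exists2 C', \det C' != 0 & W *m C = C' *m W.
  move=> uC cZC; have WC : W *m C = conjmx W C *m W.
    rewrite /conjmx mulmxKpV// eqW; apply/eigenspaceP.
    by rewrite -mulmxA -cZC mulmxA WZ scalemxAl.
  exists (conjmx W C) => //; rewrite -unitfE -unitmxE -row_free_unit.
  rewrite /row_free eqn_leq rank_leq_row -{1}(eqP freeW).
  by rewrite -(mxrankMfree W (etrans (row_free_unit C) uC)) WC mxrankM_maxl.
have [A' detA' WA] := restrW A uA cZA; have [B' detB' WB] := restrW B uB cZB.
(* On the eigenspace the relation reads [A' *m B' = a *: (B' *m A')]. *)
have : \det A' * \det B' = a ^+ \rank (eigenspace Z a) * (\det A' * \det B').
  rewrite [in RHS](mulrC (\det A')) -!det_mulmx -detZ; congr (\det _).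
  apply: (row_free_inj freeW).
  rewrite -mulmxA -WB mulmxA -WA -mulmxA AB.
  rewrite -(mulmxA B) -cZA (mulmxA B) -cZB !mulmxA WZ -!scalemxAl.
  by rewrite -(mulmxA _ A' W) -WA mulmxA -WB.
rewrite -[LHS]mul1r => /(mulIf (mulf_neq0 detA' detB')) ad.
(* The dimension lies between 1 and [n]; the factorial is an exponent common to all eigenvalues. *)
have /dvdnP[e ->] : (\rank (eigenspace Z a) %| n`!)%N.
  by rewrite dvdn_fact// lt0n mxrank_eq0 [_ != _]eigZ rank_leq_row.
by rewrite mulnC exprM -ad expr1n.
Qed.

Lemma completely_reducible_central_unipotent (F : fieldType) (n : nat)
    (G : set (GL n F)) (z : GL n F) (k : nat) :
  completely_reducible G -> center_group G z -> (GL_val z - 1) ^+ k = 0 ->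
  z = 1%g.
Proof.
move=> crG [Gz Zz]; set N := GL_val z - 1 => Nk0.
have NG g : G g -> comm_mx N (GL_val g).
  move=> /Zz/(congr1 val)/= zg.
  by rewrite /comm_mx mulmxBl mulmxBr mul1mx mulmx1; congr (_ - _).
have [|V [GV kV0 kVT]] := crG (kermx N).
  move=> g Gg; apply/sub_kermxP.
  by rewrite -mulmxA -NG// mulmxA mulmx_ker mul0mx.
(* [N] preserves [V] and is injective on it, so no power of [N] lowers the rank of [V]; the power
   [k] then forces [V = 0]. *)
have rankVN i : (V *m N ^+ i <= V)%MS /\ \rank (V *m N ^+ i) = \rank V.
  elim: i => [|i [sVi <-]]; first by rewrite expr0 mulmx1.
  rewrite exprSr mulmxA; split.
    apply: submx_trans (submxMr _ sVi) _.
    by rewrite mulmxBr mulmx1 addmx_sub ?eqmx_opp// GV.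
  apply/mxrank_injP; rewrite -submx0 -kV0 capmxC.
  by rewrite sub_capmx capmxSl (submx_trans (capmxSr _ _)).
have V0 : V = 0.
  by apply/eqP; rewrite -mxrank_eq0 -(rankVN k).2 Nk0 mulmx0 mxrank0.
apply/val_inj/eqP => /=; rewrite -subr_eq0 -[_ - _]mul1mx; apply/eqP/sub_kermxP.
by rewrite -kVT V0 addsmx0.
Qed.

(** * Generated subgroups, the lower central series and nilpotency *)

Lemma gen_subgroup_ind (gT : groupType) (A P : set gT) :
  P 1%g -> (forall x y, P x -> P y -> P (x / y)%g) -> A `<=` P ->
  gen_subgroup A `<=` P.
Proof.
(* [gen_subgroup] ranges over bundled [groupClosed] predicates, so [P] is made boolean classically
   and packed as one. *)
move=> P1 PF AP x genAx; pose S : {pred gT} := [pred y | `[< P y >]].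
have S_closed : group_closed S.
  by split=> [|y z]; rewrite !inE ?asboolE//; apply: PF.
pose i := isInvClosed.Build gT S (group_closedV S_closed).
pose m1 := isMul1Closed.Build gT S (proj1 S_closed).
pose m := isMulClosed.Build gT S (group_closedM S_closed).
pose H : groupClosed gT := HB.pack S i m1 m.
by apply: asboolW; apply: (genAx H) => y /AP Py; apply: asboolT.
Qed.

Lemma gen_subgroup1 (gT : groupType) (A : set gT) : gen_subgroup A 1%g.
Proof. by move=> H _; apply: gpred1. Qed.

Lemma sub_gen_subgroup (gT : groupType) (A : set gT) : A `<=` gen_subgroup A.
Proof. by move=> x Ax H /(_ x Ax). Qed.

Lemma lcs1 (gT : groupType) (G : groupClosed gT) i : lcs [set` G] i 1%g.
Proof. by case: i => [|i]; [apply: gpred1 | apply: gen_subgroup1]. Qed.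

Lemma lcs_sub (gT : groupType) (G : groupClosed gT) i :
  lcs [set` G] i `<=` [set` G].
Proof.
elim: i => //= i IHi x; apply=> _ [a /IHi Ga [b Gb <-]].
exact: gpredR.
Qed.

Lemma gen_subgroupF (gT : groupType) (A : set gT) x y :
  gen_subgroup A x -> gen_subgroup A y -> gen_subgroup A (x / y)%g.
Proof. by move=> gx gy H AH; apply: gpredF; [apply: gx | apply: gy]. Qed.

Lemma gen_subgroup_image (gT hT : groupType) (f : UMagmaMorphism.type gT hT)
    (A : set gT) :
  gen_subgroup (f @` A) = f @` gen_subgroup A.
Proof.
apply/seteqP; split=> [|_ [x Ax <-]].
  apply: gen_subgroup_ind => [|_ _ [x Ax <-] [y Ay <-]|_ [x Ax <-]].
  - by exists 1%g; [apply: gen_subgroup1 | apply: gmulf1].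
  - by exists (x / y)%g; [apply: gen_subgroupF | apply: gmulfF].
  - by exists x => //; apply: sub_gen_subgroup.
move: x Ax; apply: gen_subgroup_ind => [|x y fx fy|x Ax].
- by rewrite gmulf1; apply: gen_subgroup1.
- by rewrite gmulfF; apply: gen_subgroupF.
- by apply: sub_gen_subgroup; exists x.
Qed.

Lemma lcs_image (gT hT : groupType) (f : UMagmaMorphism.type gT hT)
    (G : set gT) i :
  lcs (f @` G) i = f @` lcs G i.
Proof.
elim: i => //= i ->; rewrite /commg_subgroup -gen_subgroup_image; congr gen_subgroup.
apply/seteqP; split=> [_ [_ [a La <-] [_ [b Gb <-] <-]]|_ [_ [a La [b Gb <-]] <-]].
  by exists [~ a, b]%g; [exists a => //; exists b | apply: gmulfR].
by rewrite gmulfR; exists (f a); [exists a | exists (f b) => //; exists b].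
Qed.

Lemma nilpotent_image (gT hT : groupType) (f : UMagmaMorphism.type gT hT)
    (G : set gT) :
  nilpotent_group G -> nilpotent_group (f @` G).
Proof.
by move=> [c Gc1]; exists c; rewrite lcs_image Gc1 image_set1 gmulf1.
Qed.

Lemma center_groupX (gT : groupType) (G : groupClosed gT) z m :
  center_group [set` G] z -> center_group [set` G] (z ^+ m)%g.
Proof.
move=> [Gz zG]; split=> [|g Gg]; first exact: gpredXn.
exact/commute_sym/commuteX/commute_sym/zG.
Qed.

Lemma center_group_image (gT hT : groupType) (f : UMagmaMorphism.type gT hT)
    (G : set gT) :
  f @` center_group G `<=` center_group (f @` G).
Proof.
move=> _ [z [Gz zG] <-]; split=> [|_ [g Gg <-]]; first by exists z.
exact/gmulf_commute/zG.
Qed.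

Lemma nilpotent_central_subgroup (gT : groupType) (G : groupClosed gT)
    (N : set gT) :
  (forall g h, N g -> g \in G -> h \in G -> N [~ g, h]%g) ->
  (forall g h, N g -> g \in G -> h \in G ->
     center_group [set` G] [~ g, h]%g -> [~ g, h]%g = 1%g) ->
  nilpotent_group [set` G] -> [set` G] `&` N `<=` center_group [set` G].
Proof.
move=> NG centralR1 [c Gc1].
suff: forall i, (i <= c)%N ->
    lcs [set` G] (c - i) `&` N `<=` center_group [set` G].
  by move=> /(_ c (leqnn c)); rewrite subnn.
elim=> [|i IHi] lt_ic g [Lg Ng].
  move: Lg; rewrite subn0 Gc1 => ->; split=> [|h _]; first exact: gpred1.
  by rewrite /commute mulg1 mul1g.
have Gg := lcs_sub gT G _ _ Lg.
(* The commutator lies in [N] and in the next term of the series, hence is central by induction,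
   hence trivial. *)
split=> // h Gh; rewrite /commute commgC centralR1 ?mulg1//.
apply: IHi (ltnW lt_ic) _ _; split; last exact: NG.
(* [c - i] is the successor of [c - i.+1], which lets [lcs] unfold once. *)
rewrite -(subnSK lt_ic) /=; apply: sub_gen_subgroup.
by exists g => //; exists h.
Qed.

(** Where the series of the image becomes trivial, that of [G] has entered the kernel and so the
    center; one more commutator kills it. *)
Lemma nilpotent_central_ker (gT hT : groupType)
    (f : UMagmaMorphism.type gT hT) (G : groupClosed gT) :
  nilpotent_group (f @` [set` G]) ->
  [set` G] `&` [set g | f g = 1%g] `<=` center_group [set` G] ->
  nilpotent_group [set` G].
Proof.
move=> [c fGc1] kerZ; exists c.+1; apply/seteqP; split=> [x|_ ->]; last exact: lcs1.
apply: (@gen_subgroup_ind _ _ [set 1%g]) => {x} [//|x y -> ->|_ [a La [b Gb <-]]].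
  by rewrite /= divg1.
have [|_ /(_ b Gb) ab] := kerZ a.
  split; first exact: lcs_sub La.
  have : (f @` lcs [set` G] c) (f a) by exists a.
  by rewrite -lcs_image fGc1.
by apply: (@mulgI _ (b * a)%g); rewrite -commgC mulg1.
Qed.

(** * Application to linear groups *)

Lemma GLmap_inj (n : nat) (R S : pzRingType) (f : {rmorphism R -> S}) :
  injective f -> injective (@GLmap n R S f).
Proof.
move=> f_inj g h /(congr1 val)/= /matrixP gh.
by apply/val_inj/matrixP=> i j; apply: f_inj; have := gh i j; rewrite !mxE.
Qed.

Lemma GL_valX (n : nat) (R : pzRingType) (g : GL n R) m :
  GL_val (g ^+ m)%g = GL_val g ^+ m.
Proof. by elim: m => [|m IHm]; rewrite ?expg0// expgS exprS -IHm. Qed.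

Lemma GL_unitmx (n : nat) (F : fieldType) (g : GL n F) : GL_val g \in unitmx.
Proof. by have [B [gB _]] := GL_inv_ex g; have [] := mulmx1_unit gB. Qed.

Lemma GL_unipotent (n : nat) (F : fieldType) (G : set (GL n F)) (z : GL n F) :
  completely_reducible G -> center_group G z -> unipotent_mx (GL_val z) ->
  z = 1%g.
Proof.
move=> crG Zz uz.
(* Unipotency is the case of exponent 1. *)
have [k] := @eigenvalue_root1_nilp F n 1 (GL_val z) (fun L f a => uz L f a).
exact: completely_reducible_central_unipotent crG Zz.
Qed.

(** As [G] is a mere set, centrality is asked of every power: of the commutator itself for the
    eigenvalue argument, and of its [n!]-th power for complete reducibility. *)
Lemma central_commutator_torsion (n : nat) (F : fieldType) (G : set (GL n F))
    (g h : GL n F) :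
  completely_reducible G -> G g -> G h ->
  (forall m, center_group G ([~ g, h] ^+ m)%g) -> torsion_elt [~ g, h]%g.
Proof.
move=> crG Gg Gh Zz; set z := [~ g, h]%g in Zz *.
have zC x : G x -> comm_mx (GL_val z) (GL_val x).
  by move=> Gx; have /(congr1 val) := (Zz 1).2 x Gx.
have [k] : exists k, (GL_val z ^+ n`! - 1) ^+ k = 0.
  apply: eigenvalue_root1_nilp => L f a.
  have fC x : G x -> comm_mx (map_mx f (GL_val z)) (map_mx f (GL_val x)).
    by move=> /zC zx; rewrite /comm_mx -!map_mxM zx.
  apply: (commutator_eigenvalue_root1 _ _ (map_mx f (GL_val g))
    (map_mx f (GL_val h))); rewrite ?map_unitmx ?GL_unitmx//; try exact: fC.
  by rewrite -!map_mxM; congr map_mx; have /(congr1 val) := commgC g h.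
rewrite -GL_valX => /(completely_reducible_central_unipotent _ _ _ _ _ crG (Zz _)) zn1.
by exists n`! => //; apply: fact_gt0.
Qed.

Theorem theorem4p10 (F : fieldType) (D : subringClosed F)
    (rho : ideal (subring_of D)) (n : nat)
    (G : groupClosed (GL n (subring_of D))) :
  fg_subring D ->
  fg_subgroup G ->
  ([pchar subring_of D] =i pred0 ->
     torsion_free (congruence_subgroup n rho)) ->
  ((exists p : nat, p \in [pchar subring_of D]) ->
     forall g : GL n (subring_of D),
       congruence_subgroup n rho g -> torsion_elt g ->
       unipotent_mx (map_mx (subring_val (D:=D)) (GL_val g))) ->
  completely_reducible (GLmap (subring_val (D:=D)) @` [set` G]) ->
  (nilpotent_group [set` G] <->
     nilpotent_group (psi n rho @` [set` G]) /\
     [set` G] `&` congruence_subgroup n rho `<=` center_group [set` G]).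
Proof.
move=> _ _ char0 charp crG; split=> [nilG | [nil_psiG ker_psiZ]]; last first.
  exact: (nilpotent_central_ker _ _ (psi n rho)).
split.
  exact: nilpotent_image.
have psiR1 g h : congruence_subgroup n rho g -> congruence_subgroup n rho [~ g, h]%g.
  by rewrite /congruence_subgroup /= (gmulfR (psi n rho)) /= => ->; rewrite comm1g.
apply: nilpotent_central_subgroup nilG => g h; first by move=> /psiR1.
move=> /(psiR1 _ h) psiz1 Gg Gh; set z := [~ g, h]%g in psiz1 * => Zz.
(* Complete reducibility is a condition over [F], so the commutator is studied through this
   embedding and pulled back by injectivity. *)
pose f : UMagmaMorphism.type (GL n (subring_of D)) (GL n F) :=
  GLmap (subring_val (D:=D)).
have f_inj : injective f by apply: GLmap_inj; apply: val_inj.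
have Zfz m : center_group (f @` [set` G]) (f z ^+ m)%g.
  rewrite -gmulfXn; apply: center_group_image; exists (z ^+ m)%g => //.
  exact: center_groupX.
have torz : torsion_elt z.
  have [|m m_gt0 fzm1] := central_commutator_torsion n F _ (f g) (f h) crG
    (ex_intro2 _ _ g Gg erefl) (ex_intro2 _ _ h Gh erefl).
    by move=> m; rewrite -gmulfR.
  by exists m => //; apply: f_inj; rewrite gmulf1 -fzm1 -gmulfR gmulfXn.
(* In positive characteristic the torsion element [z] is unipotent and central, hence trivial; in
   characteristic 0 torsion-freeness concludes at once. *)
have [[p charDp]|D0] := pselect (exists p : nat, p \in [pchar subring_of D]).
  apply: f_inj; rewrite gmulf1; apply: GL_unipotent crG (Zfz 1) _.
  by apply: charp psiz1 torz; exists p.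
by apply: char0 psiz1 torz => p; apply/negbTE/negP => charDp; apply: D0; exists p.
Qed.
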